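(* Let $a \ge 2$ and $m \ge 3$ be two integers, let $\{p_k\}_{k\ge 1}$ be the sequence of prime numbers, and define $$\nu = \sum_{k=1}^{\infty} \frac{p_k}{a^{k+m^k}}.$$ Then $\nu$ is a transcendental number, and it generates the primes by means of $p_1 = \lfloor a^{1+m} \nu \rfloor$ and $$p_n = \lfloor a^{n+m^{n}} \nu \rfloor - a^{1+m^n - m^{n-1}} \lfloor a^{(n-1)+m^{n-1}} \nu \rfloor \quad \text{for } n=2,3,\dots.$$
   Context: Here $p_k$ denotes the $k$th prime number in increasing order ($p_1=2$, $p_2=3$, $p_3=5$, ...), and $\lfloor x\rfloor$ denotes the integer part (floor) of the real number $x$. A real number is transcendental if it is not a root of any nonzero polynomial with integer coefficients. *)

(* Defs.v *)
From HB Require Import structures.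
From mathcomp Require Import all_boot all_order all_algebra.
From mathcomp Require Import all_classical all_reals all_analysis.

Set Implicit Arguments.
Unset Strict Implicit.
Unset Printing Implicit Defensive.

Import Order.TTheory GRing.Theory Num.Theory.
Import numFieldNormedType.Exports.

Local Open Scope ring_scope.

Lemma ex_prime_gt (n : nat) : exists q : nat, (n < q)%N && prime q.
Proof. by have [q ltnq pq] := prime_above n; exists q; rewrite ltnq pq. Qed.

Definition next_prime (n : nat) : nat := ex_minn (ex_prime_gt n).

(* Indexed from 1: [nth_prime 1 = 2], [nth_prime 2 = 3], and so on.  The value
   [nth_prime 0 = 0] is only a seed for the recursion. *)
Definition nth_prime (k : nat) : nat := iter k next_prime 0%N.

Definition transcendental (R : realType) (x : R) : Prop :=
  forall P : {poly int}, P != 0 -> ~~ root (map_poly intr P) x.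

Definition nu (R : realType) (a m : nat) : R :=
  limn (fun n => \sum_(1 <= k < n) (nth_prime k)%:R / a%:R ^+ (k + m ^ k) : R).

Lemma next_primeP (n : nat) :
  [/\ (n < next_prime n)%N, prime (next_prime n) &
      forall q, (n < q)%N -> prime q -> (next_prime n <= q)%N].
Proof.
rewrite /next_prime; case: ex_minnP => q /andP[ltnq pq] qmin; split=> // r nr pr.
by apply: qmin; rewrite nr pr.
Qed.

Lemma nth_primeS (k : nat) : nth_prime k.+1 = next_prime (nth_prime k).
Proof. by []. Qed.

Lemma prime_nth_prime (k : nat) : (0 < k)%N -> prime (nth_prime k).
Proof. by case: k => // k _; rewrite nth_primeS; case: (next_primeP (nth_prime k)). Qed.

Lemma nth_prime1 : nth_prime 1 = 2%N.
Proof.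
have [_ p1 /(_ 2%N isT isT) le2] := next_primeP 0.
by apply/eqP; rewrite eqn_leq le2 prime_gt1.
Qed.

Lemma ltn_nth_prime (i j : nat) : (i < j)%N -> (nth_prime i < nth_prime j)%N.
Proof.
elim: j => // j IH; rewrite ltnS leq_eqVlt nth_primeS.
have [lt _ _] := next_primeP (nth_prime j).
by case/orP=> [/eqP-> //|/IH/ltn_trans]; apply.
Qed.

Lemma nth_prime_le_surj (k q : nat) : prime q -> (q <= nth_prime k)%N ->
  exists2 i, (0 < i <= k)%N & nth_prime i = q.
Proof.
move=> pq; elim: k => [|k IH]; first by rewrite leqNgt prime_gt0.
move=> leq; have [/IH[i /andP[i0 ik] <-]|ltkq] := leqP q (nth_prime k).
  by exists i; rewrite // i0 leqW.
exists k.+1; rewrite ?leqnn //; apply/eqP; rewrite eqn_leq leq andbT.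
by have [_ _] := next_primeP (nth_prime k); apply.
Qed.

Lemma nth_prime_surj (q : nat) : prime q ->
  exists2 k, (0 < k)%N & nth_prime k = q.
Proof.
move=> pq; have le_id k : (k <= nth_prime k)%N.
  by elim: k => // k IH; apply: (leq_ltn_trans IH); apply: ltn_nth_prime.
by have [k /andP[k0 _] <-] := nth_prime_le_surj pq (le_id q); exists k.
Qed.

Lemma nth_primeS_le (k : nat) :
  (nth_prime k.+1 <= (\prod_(1 <= i < k.+1) nth_prime i).+1)%N.
Proof.
set N := (\prod_(1 <= i < _) _)%N.
have N0 : (0 < N)%N.
  rewrite /N big_nat_cond; apply: prodn_cond_gt0 => i /andP[/andP[i0 _] _].
  exact/prime_gt0/prime_nth_prime.
have pq : prime (pdiv N.+1) by apply: pdiv_prime.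
have [_ _ minq] := next_primeP (nth_prime k).
apply: leq_trans (pdiv_leq (ltn0Sn N)); apply: minq => //.
rewrite ltnNge; apply/negP => /(nth_prime_le_surj pq)[i /andP[i0 ik] qE].
have qN : (pdiv N.+1 %| N)%N.
  rewrite -qE /N (@big_cat_nat _ _ _ i) //=; last exact: leqW.
  by rewrite [X in (_ %| _ * X)%N]big_ltn // mulnCA dvdn_mulr.
have := pdiv_dvd N.+1; rewrite -addn1 dvdn_addr ?addn1 // dvdn1 => /eqP q1.
by rewrite q1 in pq.
Qed.

Lemma nth_prime_bound (k : nat) : (nth_prime k <= 2 ^ 2 ^ k)%N.
Proof.
have bnd n : ((\prod_(1 <= i < n.+1) nth_prime i).+1 <= 2 ^ 2 ^ n)%N.
  elim: n => [|n IH]; first by rewrite big_geq.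
  rewrite big_nat_recr //= expnSr expnM.
  set N := (\prod_(1 <= i < _) _)%N in IH *.
  apply: (@leq_trans (N.+1 ^ 2)); last by rewrite leq_exp2r.
  have := nth_primeS_le n; rewrite -/N => le.
  rewrite -mulnn mulSn addSn ltnS; apply: leq_trans (leq_addl _ _).
  by rewrite leq_mul2l le orbT.
case: k => // k; apply: leq_trans (nth_primeS_le k) _.
by apply: leq_trans (bnd k) _; rewrite !leq_exp2l.
Qed.

(* [limn] is a total operator; this lemma ensures that the
   series defining [nu] does converge, so that [nu] is not a default value. *)
Lemma is_cvg_nu (R : realType) (a m : nat) : (2 <= a)%N -> (3 <= m)%N ->
  cvgn (fun n => \sum_(1 <= k < n) (nth_prime k)%:R / a%:R ^+ (k + m ^ k) : R).
Proof.
move=> a2 m3; set u := fun k => (nth_prime k)%:R / a%:R ^+ (k + m ^ k) : R.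
have -> : (fun n => \sum_(1 <= k < n) u k) = series u.
  apply/funext => -[|n]; first by rewrite /series /= !big_geq.
  by rewrite /series /= [RHS]big_ltn // {2}/u mul0r add0r.
have a0 : (0 < a)%N by apply: leq_trans a2.
apply: (@series_le_cvg _ u (geometric 1 (2^-1))).
- by move=> k; rewrite /u divr_ge0 // exprn_ge0.
- by move=> k; rewrite /geometric /= mul1r exprn_ge0 // invr_ge0.
- move=> k; rewrite /geometric /= mul1r exprVn /u.
  rewrite ler_pdivrMr ?exprn_gt0 ?ltr0n // mulrC ler_pdivlMr ?exprn_gt0 //.
  rewrite -!natrX -natrM ler_nat.
  apply: (@leq_trans (2 ^ (k + 2 ^ k))).
    by rewrite expnD mulnC leq_mul2l nth_prime_bound orbT.
  apply: (@leq_trans (2 ^ (k + m ^ k))).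
    rewrite leq_exp2l // leq_add2l; case: k => // k.
    by rewrite leq_exp2r // ltnW.
  by case: (k + m ^ k)%N => // n; rewrite leq_exp2r.
- apply: is_cvg_geometric_series.
  by rewrite ger0_norm ?invr_ge0 // invf_lt1 // ltr1n.
Qed.

(* Main.v *)
Require Import Defs.
From HB Require Import structures.
From mathcomp Require Import all_boot all_order all_algebra.
From mathcomp Require Import all_classical all_reals all_analysis.
From mathcomp Require Import zify ring lra.

Set Implicit Arguments.
Unset Strict Implicit.
Unset Printing Implicit Defensive.

Import Order.TTheory GRing.Theory Num.Theory.
Import numFieldNormedType.Exports.

Local Open Scope ring_scope.

(** For the floor formulas, a ^ (n + m ^ n) times the n-th partial sum of the
series is an integer, and the bound p_k <= 2 ^ (2 ^ k) makes a ^ (n + m ^ n)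
times the tail smaller than 1 ([nu_le_psum], [floor_nu]); p_n is what is left
when two consecutive integers of this kind are compared.

Transcendence follows from an argument on digits, in the spirit of the elementary
proofs for the Kempner number (the sum of the a ^ (- 2 ^ k)).  Suppose that P(nu) = 0 with P of degree d and integer coefficients, and write
p_k a^(-k) a^(- m ^ k) for the k-th term.  The j-th power of a partial sum is a
sum, over j-tuples of indices, of positive terms whose size is governed by the
exponent X = m ^ k_1 + ... + m ^ k_j; the factors p_k and a^(-k) are negligible
beside a^(- m ^ k).  Aim at the exponent
  T = m ^ (n + 1) + ... + m ^ (n + d).
Its base-m digits add up to d, while a sum of j <= d powers of m has digit sum at
most j.  Hence ([power_sum_gap]) an exponent X arising from j <= d is equal to T,
which requires j = d, or it is at least T + m ^ n, or at most T - m ^ n.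

Multiply P(nu) by about a ^ (T - m ^ n).  Exponents X <= T - m ^ n give
integers.  Exponents X = T come from the leading coefficient alone; as all their
terms are positive there is no cancellation, and they contribute a nonzero amount
of size about h^-1, where h = a ^ (m ^ n).  Exponents X >= T + m ^ n, and the
error made by truncating the series, contribute O(h^-2).  The implied constants
are at most a ^ (O(2 ^ n)), which is much smaller than h because m >= 3
([scale_dominates]).  So 0 is the sum of an integer, of a small nonzero number and
of a far smaller one: the integer must be 0, and this is absurd
([nu_transcendental]). *)

(** * Sums of few powers of m *)

(** This is the subadditivity of the base-m digit sum in the form that suits
sums of powers: the exponents equal to 0 contribute the last digit r, and the
remaining multiple of m among them is carried, m ones becoming one m. *)
Lemma power_sum_last_digit (m q r : nat) (s : seq nat) : (0 < m)%N -> (r < m)%N ->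
  (\sum_(k <- s) m ^ k = q * m + r)%N ->
  exists2 s' : seq nat, (size s' + r <= size s)%N
    & (\sum_(k <- s') m ^ k = q)%N.
Proof.
move=> m0 rm sE.
have split0 : exists z t, (z + size t = size s)%N /\
    (\sum_(k <- s) m ^ k = z + (\sum_(k <- t) m ^ k) * m)%N.
  elim: s {sE} => [|[|k] s [z [t [zt sE]]]].
  - by exists 0%N, [::]; rewrite !big_nil.
  - by exists z.+1, t; rewrite big_cons sE /= addSn zt expn0; split.
  - exists z, (k :: t); rewrite !big_cons sE expnSr /=; split; lia.
have [z [t [zt sE']]] := split0.
have zr : (z %% m = r)%N.
  have := congr1 (modn^~ m) (etrans (esym sE') sE).
  by rewrite /= modnMDl addnC modnMDl (modn_small rm).
have zq : (z %/ m + \sum_(k <- t) m ^ k = q)%N.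
  have := congr1 (divn^~ m) (etrans (esym sE') sE).
  by rewrite /= divnMDl // (divn_small rm) addn0 divnDMl.
exists (nseq (z %/ m) 0%N ++ t).
  rewrite size_cat size_nseq -zt -zr.
  have := divn_eq z m; have := leq_pmulr (z %/ m) m0; lia.
rewrite big_cat /= big_nseq expn0 -zq; congr (_ + _)%N.
by rewrite iter_addn_0 mul1n.
Qed.

(** Nonzero low digits cost at least one of the powers. *)
Lemma power_sum_drop_digits (m n q r : nat) (s : seq nat) : (0 < m)%N -> (r < m ^ n)%N ->
  (\sum_(k <- s) m ^ k = q * m ^ n + r)%N ->
  exists2 s' : seq nat, (size s' + (0 < r) <= size s)%N
    & (\sum_(k <- s') m ^ k = q)%N.
Proof.
move=> m0; elim: n q r s => [|n IH] q r s.
  by rewrite expn0 ltnS leqn0 => /eqP->; rewrite muln1 addn0 => <-; exists s; rewrite ?addn0.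
move=> rm sE.
have r'm : (r %/ m < m ^ n)%N by rewrite ltn_divLR // -expnSr.
have [|s1 s1s s1E] := @power_sum_last_digit m (q * m ^ n + r %/ m) (r %% m) s m0 (ltn_pmod _ m0).
  by rewrite sE expnSr mulnDl -addnA -divn_eq mulnA.
have [s2 s2s s2E] := IH q (r %/ m)%N s1 r'm s1E.
exists s2 => //; apply: leq_trans s1s; apply: leq_trans (leq_add s2s (leqnn _)).
rewrite -addnA leq_add2l; have := divn_eq r m.
by case: (r %/ m)%N (r %% m)%N => [|x] [|y] ->; rewrite ?mul0n ?addn0 //; case: (0 < _)%N.
Qed.

Lemma repunit_power_sum_size (m d : nat) (s : seq nat) : (1 < m)%N ->
  (\sum_(k <- s) m ^ k = \sum_(i < d) m ^ i)%N -> (d <= size s)%N.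
Proof.
move=> m1; have m0 := ltnW m1; elim: d s => // d IH s sE.
have [|s' s's s'E] := @power_sum_last_digit m (\sum_(i < d) m ^ i) 1 s m0 m1.
  rewrite sE big_ord_recl expn0 addnC big_distrl; congr (_ + _)%N.
  by apply: eq_bigr => i _; rewrite expnSr.
by apply: leq_trans s's; rewrite addn1 ltnS IH.
Qed.

(** The integer T has the digit 1 at the positions n + 1, ..., n + d and 0
elsewhere, so its digit sum is d.  If X exceeds T by less than m ^ n, then its
digits are those of T followed by a nonzero low part: the digit sum exceeds d.
If X is below T by less than m ^ n, the subtraction borrows one from position
n + 1 and leaves m - 1 at position n and a nonzero part below: the digit sum is
at least (d - 1) + (m - 1) + 1. *)
Lemma power_sum_gap (m n d T X : nat) (s : seq nat) : (1 < m)%N ->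
  (size s <= d)%N -> T = (\sum_(i < d) m ^ (n.+1 + i))%N ->
  X = (\sum_(k <- s) m ^ k)%N ->
  [\/ X = T /\ size s = d, (T + m ^ n <= X)%N | (X + m ^ n <= T)%N].
Proof.
move=> m1 sd TE sX; have m0 := ltnW m1.
have {}TE : T = ((\sum_(i < d) m ^ i) * m ^ n.+1)%N.
  by rewrite TE big_distrl; apply: eq_bigr => i _; rewrite expnD mulnC.
have [gt|lt] := leqP (T + m ^ n) X; first by apply: Or32.
have [le|gt'] := leqP (X + m ^ n) T; first by apply: Or33.
apply: Or31; have [TX|XT] := leqP T X.
  have mn : (m ^ n <= m ^ n.+1)%N by rewrite leq_exp2l.
  have [||s' s's s'E] := @power_sum_drop_digits m n.+1 (\sum_(i < d) m ^ i) (X - T) s m0.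
  - lia.
  - by rewrite -TE subnKC.
  have := repunit_power_sum_size m1 s'E; move: s's; case: (posnP (X - T)%N); split; lia.
(* Here T - m ^ n < X < T, the case of the borrow. *)
exfalso; case: d sd TE => [|d] sd TE; first by rewrite TE big_ord0 in XT.
have UE : (\sum_(i < d.+1) m ^ i = (\sum_(i < d) m ^ i) * m + 1)%N.
  rewrite big_ord_recl expn0 addnC big_distrl; congr (_ + _)%N.
  by apply: eq_bigr => i _; rewrite expnSr.
have rX : (X + m ^ n - T < m ^ n)%N by lia.
rewrite UE in TE; set U := (\sum_(i < d) m ^ i)%N in TE.
have T1 : ((U * m * m + (m - 1)) * m ^ n + m ^ n = T)%N.
  rewrite TE expnS mulnDl mulnBl !mulnDl !mul1n -!mulnA.
  have : (m ^ n <= m * m ^ n)%N by rewrite leq_pmull.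
  lia.
have [|s1 s1s s1E] := @power_sum_drop_digits m n (U * m * m + (m - 1)) (X + m ^ n - T) s m0 rX.
  lia.
have [|s2 s2s s2E] := @power_sum_last_digit m (U * m) (m - 1) s1 m0 _ s1E; first lia.
have [|s3 s3s s3E] := @power_sum_last_digit m U 0 s2 m0 m0; first by rewrite addn0.
have := repunit_power_sum_size m1 s3E; lia.
Qed.

Lemma leq_exp_base (e x y : nat) : (x <= y)%N -> (x ^ e <= y ^ e)%N.
Proof. by case: e => // e xy; rewrite leq_exp2r. Qed.

(** The bound compared with a ^ (m ^ n) is a to the power O(2 ^ n), so it is enough
that (m / 2) ^ n is unbounded.  The three factors that depend on n bound the number
of d-tuples of indices, a product of d primes, and the loss a ^ (k_1 + ... + k_d)
due to the linear parts of the exponents. *)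
Lemma scale_dominates (a m d C : nat) : (2 <= a)%N -> (3 <= m)%N ->
  exists2 n : nat, (2 ^ (n + d).+1 <= m ^ n)%N
    & (C * ((n + d) ^ d * a ^ (d * 2 ^ (n + d)) * a ^ (d * (n + d)))
       < a ^ (m ^ n))%N.
Proof.
move=> a2 m3; pose K := (C + 3 * d * 2 ^ d + 2 ^ d.+1 + 1)%N; pose n := (2 * K)%N.
have a0 : (0 < a)%N by lia.
(* Bernoulli for (3 / 2) ^ k. *)
have lin k : ((k + 2) * 2 ^ k <= 2 * 3 ^ k)%N.
  by elim: k => // k; rewrite !expnS; nia.
have Kn : (K * 2 ^ n < m ^ n)%N.
  have := lin n; have : (3 ^ n <= m ^ n)%N by apply: leq_exp_base.
  have : (0 < 2 ^ n)%N by rewrite expn_gt0.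
  rewrite /n; nia.
exists n.
  rewrite -addnS expnD; have : (0 < 2 ^ n)%N by rewrite expn_gt0.
  by rewrite /K in Kn; nia.
have CE : (C <= a ^ C)%N by apply: ltnW; apply: ltn_expl.
have NE : ((n + d) ^ d <= a ^ (d * (n + d)))%N.
  rewrite mulnC expnM; apply: leq_exp_base; apply: ltnW; exact: ltn_expl.
apply: (@leq_ltn_trans (a ^ C * (a ^ (d * (n + d)) * a ^ (d * 2 ^ (n + d)) * a ^ (d * (n + d))))).
  by do !apply: leq_mul => //.
rewrite -!expnD ltn_exp2l //.
have : (n + d < 2 ^ (n + d))%N by apply: ltn_expl.
have : (0 < 2 ^ n)%N by rewrite expn_gt0.
have : (0 < 2 ^ d)%N by rewrite expn_gt0.
rewrite /K in Kn; move: (expnD 2 n d); move: Kn; set u := (2 ^ n)%N; set v := (2 ^ d)%N.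
set w := (2 ^ (n + d))%N; set y := (n + d)%N; rewrite expnS -/v => Kn wE v0 u0 yw.
have : (d * y <= d * w)%N by rewrite leq_mul2l (ltnW yw) orbT.
nia.
Qed.

(** * Partial sums of the series and the prime formulas *)

Definition psum (R : realType) (a m n : nat) : R :=
  \sum_(1 <= k < n.+1) (nth_prime k)%:R / a%:R ^+ (k + m ^ k).

Lemma psum_le_nu (R : realType) (a m n : nat) : (2 <= a)%N -> (3 <= m)%N ->
  psum R a m n <= nu R a m.
Proof.
move=> a2 m3.
have /(_ _ n.+1) := @nondecreasing_cvgn_le R _ _ (@is_cvg_nu R _ _ a2 m3).
apply; apply/nondecreasing_seqP => -[|i]; first by rewrite !big_geq.
by rewrite [leRHS]big_nat_recr //= lerDl divr_ge0 // exprn_ge0.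
Qed.

Lemma pow_gap_mono (m k n : nat) : (3 <= m)%N -> (n <= k)%N ->
  (2 ^ k + m ^ n <= m ^ k + 2 ^ n)%N.
Proof.
move=> m3 /subnK <-; elim: (k - n)%N => [|t IH]; first by rewrite addnC.
rewrite addSn !expnS; have : (2 ^ (t + n) <= m ^ (t + n))%N.
  by apply: leq_exp_base; lia.
nia.
Qed.

(** From index n + 1 on, the k-th term is at most D a^(-k), where
D = a ^ (2 ^ (n + 1) - m ^ (n + 1)), because m ^ k - 2 ^ k is nondecreasing in k;
the geometric series in a^(-k) adds up to at most a^(-n). *)
Lemma nu_le_psum (R : realType) (a m n : nat) : (2 <= a)%N -> (3 <= m)%N ->
  nu R a m <= psum R a m n + a%:R ^+ (2 ^ n.+1) / a%:R ^+ (n + m ^ n.+1).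
Proof.
move=> a2 m3; have a0 : (0 : R) < a%:R by rewrite ltr0n; lia.
have a0N k : (0 : R) < a%:R ^+ k by exact: exprn_gt0.
have a2R : (2 : R) <= a%:R by rewrite ler_nat.
pose D : R := a%:R ^+ (2 ^ n.+1) / a%:R ^+ (m ^ n.+1).
have D0 : 0 < D by rewrite divr_gt0.
have term_le k : (n < k)%N ->
    (nth_prime k)%:R / a%:R ^+ (k + m ^ k) <= D * a%:R ^- k :> R.
  move=> nk; rewrite exprD invfM mulrCA [leRHS]mulrC ler_pM2l ?invr_gt0 //.
  rewrite /D ler_pdivrMr // mulrAC ler_pdivlMr // -!natrX -!natrM ler_nat.
  apply: (@leq_trans (a ^ (2 ^ k) * a ^ (m ^ n.+1))).
    rewrite leq_mul2r (leq_trans (nth_prime_bound k)) ?orbT //.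
    exact: leq_exp_base.
  by rewrite -!expnD leq_pexp2l ?[(2 ^ n.+1 + _)%N]addnC ?pow_gap_mono //; lia.
have tail t : \sum_(n.+1 <= k < n.+1 + t) (nth_prime k)%:R / a%:R ^+ (k + m ^ k)
    <= D * (a%:R ^- n - a%:R ^- (n + t)).
  elim: t => [|t IH]; first by rewrite !addn0 big_geq // subrr mulr0.
  rewrite addnS big_nat_recr ?leq_addr //=.
  have le2 := @term_le (n.+1 + t)%N (leq_addr _ _).
  apply: le_trans (lerD IH le2) _; rewrite -mulrDr ler_pM2l //.
  have -> : a%:R ^- (n + t) = a%:R * a%:R ^- (n.+1 + t) :> R.
    by rewrite addSn exprS invfM mulrA divff ?mul1r // gt_eqF.
  have : (0 : R) < a%:R ^- (n.+1 + t) by rewrite invr_gt0.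
  rewrite -[(n + t.+1)%N]addSnnS; set z := _ ^- _; set z0 := _ ^- n; nra.
apply: limr_le (@is_cvg_nu R _ _ a2 m3) _; exists n.+1 => // i /= ni.
rewrite (@big_cat_nat _ _ _ n.+1) //= lerD2l.
rewrite -(subnKC ni); apply: le_trans (tail _) _.
rewrite [in leRHS]exprD invfM mulrCA [leRHS]mulrC -/D ler_pM2l //.
by rewrite gerBl invr_ge0 ltW.
Qed.

Lemma psum_int (R : realType) (a m n : nat) : (0 < a)%N -> (0 < m)%N ->
  a%:R ^+ (n + m ^ n) * psum R a m n \is a Num.int.
Proof.
move=> a0 m0; rewrite /psum mulr_sumr big_seq; apply: rpred_sum => k.
rewrite mem_index_iota => /andP[k1 kn].
have le : (k + m ^ k <= n + m ^ n)%N.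
  by apply: leq_add; rewrite // leq_pexp2l.
rewrite -(subnK le) exprD mulrACA divff; last by rewrite expf_neq0 // pnatr_eq0; lia.
by rewrite mulr1 rpredM ?rpredX // natr_int.
Qed.

Lemma floor_nu (R : realType) (a m n : nat) : (2 <= a)%N -> (3 <= m)%N ->
  (0 < n)%N ->
  (Num.floor (a%:R ^+ (n + m ^ n) * nu R a m))%:~R
    = a%:R ^+ (n + m ^ n) * psum R a m n :> R.
Proof.
move=> a2 m3 n0; have /intrP[z zE] : a%:R ^+ (n + m ^ n) * psum R a m n \is a Num.int.
  by apply: psum_int; lia.
have a0 : (0 : R) < a%:R ^+ (n + m ^ n) by rewrite exprn_gt0 // ltr0n; lia.
rewrite zE; congr (_%:~R); apply: floor_def; rewrite intrD -zE.
rewrite ler_pM2l // psum_le_nu //=.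
apply: (@le_lt_trans _ _ (a%:R ^+ (n + m ^ n) *
  (psum R a m n + a%:R ^+ (2 ^ n.+1) / a%:R ^+ (n + m ^ n.+1)))).
  by rewrite ler_pM2l // nu_le_psum.
rewrite mulrDr ltrD2l mulrA -exprD ltr_pdivrMr; last by rewrite exprn_gt0 // ltr0n; lia.
rewrite mul1r ltr_eXn2l ?ltr1n // -addnA ltn_add2l !expnS.
have : (2 * 2 ^ n < 2 * m ^ n)%N by rewrite ltn_mul2l /= ltn_exp2r //; lia.
nia.
Qed.

Lemma prime_formula (R : realType) (a m : nat) : (2 <= a)%N -> (3 <= m)%N ->
  forall n : nat, (2 <= n)%N ->
        (nth_prime n)%:Z =
          Num.floor (a%:R ^+ (n + m ^ n) * nu R a m)
          - a%:Z ^+ (1 + m ^ n - m ^ (n - 1))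
            * Num.floor (a%:R ^+ ((n - 1) + m ^ (n - 1)) * nu R a m).
Proof.
move=> a2 m3 [//|n] n1; rewrite subSS subn0.
have an0 k : a%:R ^+ k != 0 :> R by rewrite expf_neq0 // pnatr_eq0; lia.
apply: (@intr_inj R); rewrite rmorphB rmorphM rmorphXn /= !floor_nu //.
have mn : (m ^ n <= m ^ n.+1)%N by rewrite leq_pexp2l //; lia.
rewrite !pmulrn mulrA -exprD.
have -> : (1 + m ^ n.+1 - m ^ n + (n + m ^ n) = n.+1 + m ^ n.+1)%N by lia.
rewrite {1}/psum big_nat_recr //= mulrDr [X in _ = X + _ - _]mulrC.
by rewrite /psum [a%:R ^+ _ * (\sum_(_ <= _ < _) _)]mulrC addrC addKr mulrCA divff ?mulr1.
Qed.

Lemma prime_formula1 (R : realType) (a m : nat) : (2 <= a)%N -> (3 <= m)%N ->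
  (nth_prime 1)%:Z = Num.floor (a%:R ^+ (1 + m) * nu R a m).
Proof.
move=> a2 m3; apply: (@intr_inj R); rewrite -[in (1 + m)%N](expn1 m) floor_nu //.
by rewrite /psum big_nat1 mulrCA divff ?mulr1 // expf_neq0 // pnatr_eq0; lia.
Qed.

(** * Powers of nu near the target exponent *)

Lemma psum_pow (R : realType) (a m N j : nat) :
  psum R a m N ^+ j = \sum_(f : {ffun 'I_j -> 'I_N})
    (\prod_i nth_prime (f i).+1)%:R
      / a%:R ^+ (\sum_i (f i).+1 + \sum_i m ^ (f i).+1).
Proof.
rewrite /psum big_add1 big_mkord -[in LHS](card_ord j) -prodr_const.
rewrite bigA_distr_bigA; apply: eq_bigr => f _.
by rewrite big_split /= prodfV -natr_prod -big_split /= prodrXr.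
Qed.

Lemma prime_prod_bounds (N d j : nat) (f : {ffun 'I_j -> 'I_N}) : (j <= d)%N ->
  (0 < \prod_i nth_prime (f i).+1 <= 2 ^ (d * 2 ^ N))%N.
Proof.
move=> jd; apply/andP; split.
  by apply: prodn_gt0 => i; rewrite prime_gt0 // prime_nth_prime.
apply: (@leq_trans (\prod_(i < j) 2 ^ 2 ^ N)%N).
  apply: leq_prod => i _; apply: leq_trans (nth_prime_bound _) _.
  by rewrite !leq_exp2l.
by rewrite prod_nat_const card_ord -expnM leq_exp2l // mulnC leq_mul2r jd orbT.
Qed.

Lemma sum_le_card (R : realType) (I : finType) (P : pred I) (F : I -> R) (B : R) :
  0 <= B -> (forall i, P i -> F i <= B) -> \sum_(i | P i) F i <= #|I|%:R * B.
Proof.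
move=> B0 FB; rewrite big_mkcond /= mulr_natl -sumr_const.
by apply: ler_sum => i _; case: ifP => // /FB.
Qed.

Section Split.
Variables (R : realType) (a m n d : nat).
Hypotheses (a2 : (2 <= a)%N) (m3 : (3 <= m)%N).
Let b : R := a%:R.
(* The partial sum stops at N, the largest index used by the target exponent. *)
Let N := (n + d)%N.
Let T := (\sum_(i < d) m ^ (n.+1 + i))%N.
Let h : R := b ^+ (m ^ n).
(* The scaling factor.  Its part b ^ (d * N) absorbs the linear parts k of the
   exponents k + m ^ k: at most d of them are added, each at most N. *)
Let A : R := b ^+ (T + d * N) / h.
(* Number of tuples, times a bound for the product of primes, times b ^ (d * N). *)
Let Q : R := (N ^ d * a ^ (d * 2 ^ N) * a ^ (d * N))%:R.

(** The three outcomes of [power_sum_gap] for the exponent X of a tuple: the tuples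
with X = T are collected in x, those with X >= T + m ^ n in y, and the others give
an integer.  The lower bound on x comes from the tuple (n + 1, ..., n + d)
alone, since the other terms of x are nonnegative. *)
Lemma psum_pow_split (j : nat) : (j <= d)%N ->
  exists x y : R, [/\ psum R a m N ^+ j * A - x - y \is a Num.int,
    0 <= x <= Q / h, 0 <= y <= Q / h ^+ 2,
    (j < d)%N -> x = 0 & j = d -> h^-1 <= x].
Proof.
move=> jd; have b0 : 0 < b by rewrite ltr0n; lia.
have b1 : 1 <= b by rewrite ler1n; lia.
have bX k : 0 < b ^+ k by exact: exprn_gt0.
have h0 : 0 < h by exact: bX.
pose w (f : {ffun 'I_j -> 'I_N}) := (\prod_i nth_prime (f i).+1)%N.
pose s (f : {ffun 'I_j -> 'I_N}) := (\sum_i (f i).+1)%N.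
pose X (f : {ffun 'I_j -> 'I_N}) := (\sum_i m ^ (f i).+1)%N.
pose t f := (w f)%:R / b ^+ (s f + X f) * A.
have w0 f : (0 < w f)%N by have /andP[] := prime_prod_bounds f jd.
have wW f : (w f <= a ^ (d * 2 ^ N))%N.
  have /andP[_ /leq_trans] := prime_prod_bounds f jd; apply.
  exact: leq_exp_base.
have sN f : (s f <= d * N)%N.
  apply: (@leq_trans (\sum_(i < j) N)%N); first exact: leq_sum.
  by rewrite sum_nat_const card_ord leq_mul2r jd orbT.
have gap f : [\/ X f = T /\ j = d, (T + m ^ n <= X f)%N | (X f + m ^ n <= T)%N].
  have := @power_sum_gap m n d T (X f) (codom (fun i => (f i).+1)).
  rewrite size_codom card_ord; apply=> //; first lia.
  by rewrite /X /codom big_image.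
have t0 f : 0 <= t f by rewrite /t !mulr_ge0 ?invr_ge0 ?(ltW (bX _)) ?(ltW h0).
pose B e : R := (a ^ (d * 2 ^ N) * a ^ (d * N))%:R / (h * b ^+ e).
have B0 e : 0 <= B e by rewrite /B divr_ge0 // mulr_ge0 ?(ltW h0) ?(ltW (bX _)).
have tB e f : (T + e <= X f)%N -> t f <= B e.
  move=> TeX; rewrite /t /A /B mulf_div ler_pdivrMr ?mulr_gt0 //.
  rewrite mulrAC ler_pdivlMr ?mulr_gt0 //.
  rewrite natrM !natrX -/b.
  have le1 : (w f)%:R <= b ^+ (d * 2 ^ N) by rewrite -natrX ler_nat.
  have le2 : b ^+ (T + d * N) * b ^+ e <= b ^+ (d * N) * b ^+ (s f + X f).
    by rewrite -!exprD ler_weXn2l //; lia.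
  have := ler_pM (ler0n _ _) (ltW (mulr_gt0 (bX _) (bX _))) le1 le2.
  rewrite -(ler_pM2r h0); set p := _%:R; set c := b ^+ (T + _); set c' := b ^+ e.
  set g := b ^+ (d * 2 ^ N); set g' := b ^+ (d * N); set k := b ^+ (s f + _).
  have -> : p * (c * c') * h = p * c * (h * c') by ring.
  by have -> : g * (g' * k) * h = g * g' * (k * h) by ring.
have sumB e (P : pred {ffun 'I_j -> 'I_N}) : (forall f, P f -> (T + e <= X f)%N) ->
    0 <= \sum_(f | P f) t f <= Q / (h * b ^+ e).
  move=> PX; rewrite sumr_ge0 //=.
  apply: le_trans (sum_le_card (B0 e) (fun f Pf => tB e f (PX f Pf))) _.
  rewrite card_ffun !card_ord /B mulrA -natrM /Q -mulnA ler_pM2r ?invr_gt0 ?mulr_gt0 //.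
  rewrite ler_nat leq_mul2r; apply/orP; right.
  case: (posnP N) => [N0|N0]; last by rewrite leq_pexp2l.
  (* Then d = 0 as well, and both powers are 0 ^ 0. *)
  have -> : j = d by rewrite /N in N0; lia.
  by [].
exists (\sum_(f | X f == T) t f), (\sum_(f | (X f != T) && (T + m ^ n <= X f)%N) t f).
split.
- have -> : psum R a m N ^+ j * A = \sum_f t f by rewrite psum_pow mulr_suml.
  have cancel (u v z : R) : u + (v + z) - u - v = z by ring.
  rewrite (bigID (fun f => X f == T)) /=.
  rewrite [in X in _ + X - _ - _](bigID (fun f => (T + m ^ n <= X f)%N)) /= cancel.
  apply: rpred_sum => f /andP[/negPf neT /negPf ltT].
  have [[/eqP]|//|XT] := gap f; rewrite ?neT ?ltT //.
  rewrite /t /A mulf_div.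
  have -> : b ^+ (T + d * N) = b ^+ (T + d * N - (s f + X f + m ^ n)) * (b ^+ (s f + X f) * h).
    by rewrite -!exprD; congr (_ ^+ _); have := sN f; lia.
  rewrite [X in X / _]mulrA mulfK ?mulf_neq0 ?gt_eqF //.
  by rewrite rpredM ?rpredX ?natr_int.
- by have := @sumB 0%N (fun f => X f == T); rewrite mulr1; apply=> f /eqP->; lia.
- have := @sumB (m ^ n)%N (fun f => (X f != T) && (T + m ^ n <= X f)%N).
  by rewrite -/h -expr2; apply=> f /andP[].
- move=> jlt; rewrite big_pred0 // => f; apply/eqP => XT.
  have : (0 < m ^ n)%N by rewrite expn_gt0; lia.
  by have [[_]||] := gap f; lia.
- move=> jE; pose f0 : {ffun 'I_j -> 'I_N} := [ffun i => rshift n (cast_ord jE i)].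
  have X0 : X f0 == T.
    have -> : T = (\sum_(i < j) m ^ (n.+1 + i))%N by rewrite jE.
    by apply/eqP; apply: eq_bigr => i _; rewrite ffunE.
  rewrite (bigD1 f0) //=; apply: ler_wpDr; first by rewrite sumr_ge0.
  rewrite /t /A mulrA ler_peMl ?invr_ge0 ?(ltW h0) //.
  rewrite mulrAC ler_pdivlMr // mul1r (eqP X0).
  apply: (@le_trans _ _ (b ^+ (T + d * N))).
    by rewrite ler_weXn2l //; have := sN f0; lia.
  by rewrite ler_peMl ?(ltW (bX _)) // ler1n.
Qed.

(** By this bound, m ^ (N + 1) leaves room beyond T + m ^ n, so that the tail of the
series after index N is as small as the tuples with exponent at least T + m ^ n. *)
Lemma target_exponent_bound : (T + 2 * m ^ n <= m ^ N.+1)%N.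
Proof.
rewrite /T /N; elim: d => [|e IH].
  by rewrite big_ord0 addn0 add0n expnS leq_mul2r (ltnW m3) orbT.
rewrite big_ord_recr /= addnS; move: IH.
rewrite [(m ^ (n + e).+2)%N]expnS -[(n + e).+1]addSn.
have : (2 * m ^ (n.+1 + e) <= m * m ^ (n.+1 + e))%N.
  by rewrite leq_mul2r (ltnW m3) orbT.
move: (\sum_(_ < e) _)%N (m ^ (n.+1 + e))%N => v u; lia.
Qed.

(** Since 0 <= psum <= nu <= 1, replacing the partial sum by nu changes its j-th
power by at most j times the tail, an amount that fits into y.  The condition on n
makes h dominate the factor a ^ (2 ^ (N + 1)) in the bound for the tail. *)
Lemma nu_pow_split (j : nat) : (2 ^ N.+1 <= m ^ n)%N -> (j <= d)%N ->
  exists x y : R, [/\ nu R a m ^+ j * A - x - y \is a Num.int,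
    0 <= x <= Q / h, 0 <= y <= d.+1%:R * Q / h ^+ 2,
    (j < d)%N -> x = 0 & j = d -> h^-1 <= x].
Proof.
move=> hn jd; have b0 : 0 < b by rewrite ltr0n; lia.
have b1 : 1 <= b by rewrite ler1n; lia.
have bX k : 0 < b ^+ k by exact: exprn_gt0.
have h0 : 0 < h by exact: bX.
have A0 : 0 < A by rewrite divr_gt0.
have [x [y [xyi xb /andP[y0 yb] x0 xd]]] := psum_pow_split jd.
set S := psum R a m N in xyi; set v := nu R a m.
have S0 : 0 <= S by apply: sumr_ge0 => k _; rewrite divr_ge0 // exprn_ge0.
have Sv : S <= v by exact: psum_le_nu.
have v1 : v <= 1.
  apply: le_trans (nu_le_psum R 0 a2 m3) _.
  rewrite /psum big_geq // add0r ler_pdivrMr // mul1r.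
  by rewrite ler_weXn2l // !expn1 add0n ltnW.
have vS : (v - S) * A <= b ^+ (d * N) / h ^+ 2.
  have le : v - S <= b ^+ (2 ^ N.+1) / b ^+ (N + m ^ N.+1).
    by rewrite lerBlDl nu_le_psum.
  apply: le_trans (ler_wpM2r (ltW A0) le) _.
  rewrite /A mulf_div ler_pdivrMr ?mulr_gt0 // mulrAC ler_pdivlMr ?exprn_gt0 //.
  rewrite /h -!exprM -!exprD ler_weXn2l //.
  have arith (t u c w e k : nat) : (u <= c)%N -> (t + 2 * c <= w)%N ->
    (u + (t + k) + c * 2 <= k + (e + w + c))%N by clear; lia.
  exact: arith hn target_exponent_bound.
have pS : 0 <= v ^+ j - S ^+ j <= j%:R * (v - S).
  rewrite subrXX mulrC; apply/andP; split.
    apply: mulr_ge0; last by rewrite subr_ge0.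
    by apply: sumr_ge0 => i _; rewrite mulr_ge0 // exprn_ge0 // (le_trans S0).
  apply: ler_wpM2r; first by rewrite subr_ge0.
  rewrite -[X in _ <= X%:R](card_ord j) -sumr_const; apply: ler_sum => i _.
  by rewrite mulr_ile1 ?exprn_ge0 ?exprn_ile1 // ?(le_trans S0) // (le_trans Sv).
exists x, (y + (v ^+ j - S ^+ j) * A); split=> //.
  by have -> : v ^+ j * A - x - (y + (v ^+ j - S ^+ j) * A) = S ^+ j * A - x - y by ring.
have /andP[p0 p1] := pS.
rewrite addr_ge0 ?(mulr_ge0 p0 (ltW A0)) //= -natr1 2![in leRHS]mulrDl mul1r addrC lerD //.
apply: le_trans (ler_wpM2r (ltW A0) p1) _.
rewrite -!mulrA; apply: ler_pM => //; first by rewrite mulr_ge0 ?subr_ge0 ?(ltW A0).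
  by rewrite ler_nat.
apply: le_trans vS _; rewrite ler_pM2r ?invr_gt0 ?exprn_gt0 //.
rewrite /Q /b -natrX ler_nat leq_pmull // muln_gt0 !expn_gt0 (ltnW a2) andbT.
by case: (posnP N) => [/eqP|//]; rewrite addn_eq0 => /andP[_ ->].
Qed.

End Split.

(** * Transcendence of nu *)

Lemma nu_transcendental (R : realType) (a m : nat) : (2 <= a)%N -> (3 <= m)%N ->
  transcendental (nu R a m).
Proof.
move=> a2 m3 P P0; apply/negP => /rootP.
pose d := (size P).-1; pose c (j : nat) : R := (P`_j)%:~R.
have sP : size P = d.+1 by rewrite prednK // lt0n size_poly_eq0.
rewrite (@horner_coef_wide _ d.+1) => [P_nu|]; last first.
  by rewrite -sP; apply: size_poly.
have {P_nu} c_nu : \sum_(j < d.+1) c j * nu R a m ^+ j = 0.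
  by rewrite -[RHS]P_nu; apply: eq_bigr => j _; rewrite coef_map.
pose C := (\sum_(j < d.+1) `|(P`_j)%R|)%N.
have [n hn Cn] := scale_dominates d (C * (2 * d.+1)) a2 m3.
pose h : R := a%:R ^+ (m ^ n).
pose A : R := a%:R ^+ (\sum_(i < d) m ^ (n.+1 + i) + d * (n + d)) / h.
pose Q : R := ((n + d) ^ d * a ^ (d * 2 ^ (n + d)) * a ^ (d * (n + d)))%:R.
have h1 : 1 <= h by rewrite exprn_ege1 // ler1n; lia.
have h0 : 0 < h by exact: lt_le_trans h1.
have /choice[x /choice[y xyP]] : forall j : 'I_d.+1, exists x y : R,
    [/\ nu R a m ^+ j * A - x - y \is a Num.int,
    0 <= x <= Q / h, 0 <= y <= d.+1%:R * Q / h ^+ 2,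
    (j < d)%N -> x = 0 & j = d :> nat -> h^-1 <= x].
  by move=> j; apply: nu_pow_split; rewrite // -ltnS.
pose q : R := C%:R * (d.+1%:R * Q).
have q0 : 0 <= q by rewrite !mulr_ge0.
have qh : 2 * q < h.
  by rewrite /q /Q /h -natrX -!natrM ltr_nat; apply: leq_ltn_trans Cn; lia.
have sumc (u : 'I_d.+1 -> R) (B : R) : (forall j, 0 <= u j <= B) ->
    `|\sum_(j < d.+1) c j * u j| <= C%:R * B.
  move=> uB; apply: le_trans (ler_norm_sum _ _ _) _.
  rewrite /C natr_sum mulr_suml; apply: ler_sum => j _.
  have /andP[u0 u1] := uB j.
  by rewrite normrM (ger0_norm u0) /c -intr_norm -abszE ler_wpM2l.
(* I is the integer part, c d * x ord_max the main part, Y the remainder. *)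
pose Y := \sum_(j < d.+1) c j * y j.
pose I := \sum_(j < d.+1) c j * (nu R a m ^+ j * A - x j - y j).
have cx : \sum_(j < d.+1) c j * x j = c d * x ord_max.
  rewrite big_ord_recr /= big1 ?add0r // => j _.
  by have [_ _ _ /(_ (ltn_ord j)) -> _] := xyP (widen_ord (leqnSn d) j); rewrite mulr0.
have IE : I = - (c d * x ord_max + Y).
  have splitE : I + (c d * x ord_max + Y) = (\sum_(j < d.+1) c j * nu R a m ^+ j) * A.
    rewrite -cx /I /Y -!big_split mulr_suml /=.
    by apply: eq_bigr => j _; ring.
  by apply/eqP; rewrite -addr_eq0 splitE c_nu mul0r.
have Yq : `|Y| <= q / h ^+ 2.
  by rewrite /q -mulrA; apply: sumc => j; case: (xyP j).
have xq : `|c d * x ord_max| <= q / h.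
  have := sumc _ _ (fun j => let: And5 _ xj _ _ _ := xyP j in xj).
  rewrite cx => /le_trans; apply; rewrite /q -mulrA.
  apply: ler_wpM2l => //; apply: ler_wpM2r; first by rewrite invr_ge0 ltW.
  by rewrite ler_peMl // ler1n.
have hx : h^-1 <= `|c d * x ord_max|.
  have [_ /andP[x0 _] _ _ /(_ erefl) hx] := xyP ord_max.
  rewrite normrM (ger0_norm x0); apply: le_trans hx _.
  rewrite ler_peMl // /c -intr_norm ler1z.
  have : lead_coef P != 0 by rewrite lead_coef_eq0.
  by rewrite lead_coefE -/d; lia.
have qh2 : q / h < 2^-1 by rewrite ltr_pdivrMr //; lra.
have qhh : q / h ^+ 2 < h^-1 / 2.
  by rewrite expr2 invfM mulrA mulrC ltr_pM2l ?invr_gt0 //; lra.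
have hi1 : h^-1 <= 1 by rewrite invf_le1.
have I0 : I = 0.
  have intI : I \is a Num.int.
    by apply: rpred_sum => j _; rewrite rpredM ?intr_int //; case: (xyP j).
  have : `|I| < 1.
    by rewrite IE normrN; apply: le_lt_trans (ler_normD _ _) _; lra.
  by apply: contraTeq => /(norm_intr_ge1 intI); rewrite leNgt.
have xY : c d * x ord_max = - Y by move: IE; rewrite I0; lra.
have : 0 < h^-1 by rewrite invr_gt0.
rewrite xY normrN in hx; lra.
Qed.

Theorem theorem2 (R : realType) (a m : nat) (ha : (2 <= a)%N) (hm : (3 <= m)%N) :
  [/\ transcendental (nu R a m),
      (nth_prime 1)%:Z = Num.floor (a%:R ^+ (1 + m) * nu R a m) &
      forall n : nat, (2 <= n)%N ->
        (nth_prime n)%:Z =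
          Num.floor (a%:R ^+ (n + m ^ n) * nu R a m)
          - a%:Z ^+ (1 + m ^ n - m ^ (n - 1))
            * Num.floor (a%:R ^+ ((n - 1) + m ^ (n - 1)) * nu R a m)].
Proof.
split; [exact: nu_transcendental|exact: prime_formula1|exact: prime_formula].
Qed.
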